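(* Let $R$ be a ring with identity and let $U$ be a uniserial right $R$-module of type $1$ such that $S=\mathrm{End}(U)$ contains a monomorphism which is not onto. Then there exists a uniserial right $R$-module $V$ without an $\mathrm{Add}(U)$-cover.
   Context: A module is uniserial if its lattice of submodules is linearly ordered by inclusion. A non-zero uniserial module $U$ is of type $1$ if its endomorphism ring $S=\mathrm{End}(U)$ is a local ring (equivalently, the ideals $I=\{f\in S\mid f \text{ not monic}\}$ and $K=\{f\in S\mid f\text{ not epi}\}$ of $S$ are comparable). $\mathrm{Add}(U)$ denotes the class of all right $R$-modules isomorphic to a direct summand of a direct sum $U^{(X)}$ of copies of $U$, $X$ any set. An $\mathrm{Add}(U)$-precover of a right $R$-module $A$ is a homomorphism $f\colon C\to A$ with $C\in\mathrm{Add}(U)$ such that every homomorphism $C'\to A$ with $C'\in\mathrm{Add}(U)$ factors through $f$; it is an $\mathrm{Add}(U)$-cover if moreover every endomorphism $h$ of $C$ with $fh=f$ is an automorphism. *)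

(* Defs.v *)
From HB Require Import structures.
From mathcomp Require Import all_boot all_order all_algebra.
From mathcomp Require Import all_classical.

Set Implicit Arguments.
Unset Strict Implicit.
Unset Printing Implicit Defensive.

Import GRing.Theory.
Local Open Scope ring_scope.

(* A right module over a ring R is an lmodType over the converse ring R^c.
   The definitions below are for lmodType's over an arbitrary ring K, and are
   meant to be used with K := R^c.
   Submodules and right ideals are boolean predicates; by classical logic every
   subset of a module or of a ring is of this form. *)

Definition uniserial (K : pzRingType) (M : lmodType K) : Prop :=
  forall A B : {pred M}, submod_closed A -> submod_closed B ->
    {subset A <= B} \/ {subset B <= A}.

Definition right_ideal (S : pzRingType) (I : {pred S}) : Prop :=
  zmod_closed I /\ (forall x a, x \in I -> x * a \in I).

Definition maximal_right_ideal (S : pzRingType) (I : {pred S}) : Prop :=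
  [/\ right_ideal I, 1 \notin I
    & forall J : {pred S}, right_ideal J -> 1 \notin J ->
        {subset I <= J} -> J =i I].

(* A ring with a unique maximal right ideal; it is automatically non-zero, and
   the condition is left-right symmetric. *)
Definition local_ring (S : pzRingType) : Prop :=
  exists2 I : {pred S}, maximal_right_ideal I
    & forall J : {pred S}, maximal_right_ideal J -> J =i I.

Definition End_mod (K : pzRingType) (M : lmodType K) : Type := {linear M -> M}.

Section EndRing.
Context (K : pzRingType) (M : lmodType K).
Local Notation S := (End_mod M).

HB.instance Definition _ := gen_eqMixin S.
HB.instance Definition _ := gen_choiceMixin S.

Definition End_fun : S -> {linear M -> M} := id.

Lemma End_ext (f g : S) : End_fun f =1 End_fun g -> f = g.
Proof.
rewrite /End_fun; case: f => f Hf; case: g => g Hg /= /funext fg.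
case: _ / fg Hg => Hg.
case: Hf Hg => [[p1] [q1]] [[p2] [q2]].
by rewrite (Prop_irrelevance p1 p2) (Prop_irrelevance q1 q2).
Qed.

Definition End_zero : S := \0.
Definition End_one : S := idfun.
Definition End_opp (f : S) : S := \- End_fun f.
Definition End_add (f g : S) : S := End_fun f \+ End_fun g.
Definition End_mul (f g : S) : S := End_fun f \o End_fun g.

Fact End_addA : associative End_add.
Proof. by move=> f g h; apply: End_ext => x /=; rewrite addrA. Qed.
Fact End_addC : commutative End_add.
Proof. by move=> f g; apply: End_ext => x /=; rewrite addrC. Qed.
Fact End_add0 : left_id End_zero End_add.
Proof. by move=> f; apply: End_ext => x /=; rewrite add0r. Qed.
Fact End_addN : left_inverse End_zero End_opp End_add.
Proof. by move=> f; apply: End_ext => x /=; rewrite addNr. Qed.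

HB.instance Definition _ :=
  GRing.isZmodule.Build S End_addA End_addC End_add0 End_addN.

Fact End_mulA : associative End_mul.
Proof. by move=> f g h; apply: End_ext. Qed.
Fact End_mul1l : left_id End_one End_mul.
Proof. by move=> f; apply: End_ext. Qed.
Fact End_mul1r : right_id End_one End_mul.
Proof. by move=> f; apply: End_ext. Qed.
Fact End_mulDl : left_distributive End_mul +%R.
Proof. by move=> f g h; apply: End_ext. Qed.
Fact End_mulDr : right_distributive End_mul +%R.
Proof. by move=> f g h; apply: End_ext => x /=; rewrite raddfD. Qed.

HB.instance Definition _ := GRing.Zmodule_isPzRing.Build S
  End_mulA End_mul1l End_mul1r End_mulDl End_mulDr.

End EndRing.

Definition uniserial_type1 (K : pzRingType) (U : lmodType K) : Prop :=
  [/\ uniserial U, (exists x : U, x != 0) & local_ring (End_mod U)].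

Section DirectSum.
Context (K : pzRingType) (U : lmodType K) (X : Type).

Definition finsupp_fun : {pred X -> U} :=
  fun f => `[< finite_set [set x | f x != 0]%classic >].

Fact finsupp_fun_submod_closed : submod_closed finsupp_fun.
Proof.
split.
  apply/asboolP; apply: (sub_finite_set _ (finite_set0 X)) => x /=.
  by rewrite eqxx.
move=> a f g /asboolP Ff /asboolP Fg; apply/asboolP.
apply: (sub_finite_set (B := ([set x | f x != 0%R] `|` [set x | g x != 0%R])%classic)).
  move=> x /= nz; case: (eqVneq (f x) 0) => [fx|]; last by left.
  right; apply: contraNneq nz => gx.
  by rewrite /GRing.add /GRing.scale /= fx gx scaler0 addr0.
by rewrite finite_setU.
Qed.

HB.instance Definition _ :=
  GRing.isSubmodClosed.Build K (X -> U) finsupp_fun finsupp_fun_submod_closed.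

(* The direct sum U^(X). *)
Record direct_power :=
  DirectPower { dp_fun :> X -> U; _ : dp_fun \in finsupp_fun }.

HB.instance Definition _ := [isSub for dp_fun].
HB.instance Definition _ := [Choice of direct_power by <:].
HB.instance Definition _ :=
  [SubChoice_isSubLmodule of direct_power by <:].

End DirectSum.

Definition direct_summand (K : pzRingType) (M : lmodType K) (D : {pred M})
    : Prop :=
  submod_closed D /\
  exists E : {pred M}, [/\ submod_closed E,
    forall x, x \in D -> x \in E -> x = 0
  & forall x, exists d e, [/\ d \in D, e \in E & x = d + e]].

Definition in_Add (K : pzRingType) (U C : lmodType K) : Prop :=
  exists (X : Type) (D : {pred direct_power U X}), direct_summand D /\
    exists g : {linear C -> direct_power U X},
      injective g /\ (forall y, y \in D <-> exists c, g c = y).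

Definition Add_precover (K : pzRingType) (U A C : lmodType K)
    (f : {linear C -> A}) : Prop :=
  in_Add U C /\
  forall (C' : lmodType K) (g : {linear C' -> A}), in_Add U C' ->
    exists h : {linear C' -> C}, f \o h =1 g.

Definition Add_cover (K : pzRingType) (U A C : lmodType K)
    (f : {linear C -> A}) : Prop :=
  Add_precover U f /\
  forall h : {linear C -> C}, f \o h =1 f -> bijective h.

(* Main.v *)
From HB Require Import structures.
Require Import Defs.
From mathcomp Require Import all_boot all_order all_algebra.
From mathcomp Require Import all_classical.

(** Let [phi] be a monomorphism of [U] which is not onto, and let [M] be the
    maximal ideal of the local ring [End U].

    Extending [U] along [phi] again and again, and taking unions at limit
    stages, gives longer and longer chains of copies of [U].  The unions that
    occur are uniserial, and not all of them can be isomorphic to [U]: otherwise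
    the chain could be prolonged until its union has more elements than [U].
    So there is a uniserial [V] which is a union of submodules isomorphic to
    [U], but is not itself isomorphic to [U] ([exists_uniserial_union]).

    Such a [V] has no cover ([no_Add_cover]).  No [g : U -> V] is onto: when it
    is not monic, its sum with an embedding [U -> V] is an isomorphism
    ([mono_add_epi_iso]).  So [g U] is proper, hence lies in a larger
    copy [j U] of [U], and [g = j e] where [e] is not onto, so that
    [e] is not a unit and lies in [M].  Now let [f : C -> V] be a cover, and
    let [C] be a retract of [U^(X)] through [i : C -> U^(X)] and
    [p : U^(X) -> C].  The components of [f p] factor as [j_x e_x] with
    [e_x] in [M]; the map [(j_x)_x] lifts to some
    [k : U^(X) -> C] with [f k = (j_x)_x], so that [f k E = f p], where [E] is
    the diagonal endomorphism with entries [e_x].  Then [f (k E i) = f], and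
    [k E i] must be an automorphism of [C], with inverse [q].  The elements of
    [i C] are therefore fixed by [(i q k) E].  On the finite support of such an
    element this is a system of equations with coefficients in [M], and
    Nakayama's elimination shows that the element vanishes
    ([radical_diagonal_fixed0]).  Hence [C = 0], although nonzero maps
    [U -> V] factor through [f].

    All computations take place in [U^(X)], so [C] need not be decomposed into
    copies of [U]. *)

Set Implicit Arguments.
Unset Strict Implicit.
Unset Printing Implicit Defensive.

Import GRing.Theory.
Local Open Scope ring_scope.

(** * The maximal ideal of a local ring *)

Section LocalRing.
Context (S : pzRingType).

Lemma right_ideal_principal (x : S) :
  right_ideal (fun y => `[< exists a, y = x * a >]).
Proof.
split; last first.
  by move=> _ b /asboolP[a ->]; apply/asboolP; exists (a * b); rewrite mulrA.
split; first by apply/asboolP; exists 0; rewrite mulr0.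
move=> _ _ /asboolP[a ->] /asboolP[b ->].
by apply/asboolP; exists (a - b); rewrite mulrBr.
Qed.

(** Zorn's lemma on the proper right ideals containing [x]; the principal
    ideal [x S] is one of them. *)
Lemma maximal_right_ideal_exists (x : S) : (forall a, x * a <> 1) ->
  exists2 I : {pred S}, maximal_right_ideal I & x \in I.
Proof.
move=> xN1.
pose proper (A : set S) :=
  [/\ right_ideal (fun y => `[< A y >]), ~ A 1 & A x].
(* The empty set is admitted because the union of the empty chain is empty. *)
have proper_bigcup (F : set (set S)) :
    (F `<=` [set A | A = set0 \/ proper A])%classic -> total_on F subset ->
    (\bigcup_(A in F) A = set0 \/ proper (\bigcup_(A in F) A))%classic.
  move=> FP Ftot.
  case: (pselect (exists2 A, F A & proper A)) => [[A0 FA0 pA0]|nF].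
    have properP A y : F A -> A y -> proper A.
      by move=> FA Ay; case: (FP A FA) => // A_0; rewrite A_0 in Ay.
    right; split.
    - split; last first.
        move=> y a /asboolP[A FA Ay]; apply/asboolP; exists A => //.
        have [[_ +] _ _] := properP _ _ FA Ay => /(_ y a).
        by move=> /(_ (asboolT Ay))/asboolP.
      split.
        have [[[+ _] _] _ _] := pA0 => /asboolP A00.
        by apply/asboolP; exists A0.
      move=> y z /asboolP[A FA Ay] /asboolP[B FB Bz].
      have [C [FC Cy Cz]] : exists C, [/\ F C, C y & C z].
        case: (Ftot _ _ FA FB) => AB; [exists B|exists A]; split=> //;
          exact: AB.
      have [[[_ +] _] _ _] := properP _ _ FC Cy => /(_ y z).
      move=> /(_ (asboolT Cy) (asboolT Cz))/asboolP Cyz.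
      by apply/asboolP; exists C.
    - by move=> [A FA A1]; have [_ + _] := properP _ _ FA A1.
    - by exists A0 => //; case: pA0.
  left; rewrite -subset0 => y [A FA Ay]; case: (FP A FA) => [A_0|pA].
    by rewrite A_0 in Ay.
  by case: nF; exists A.
have [A [A0p Amax]] := Zorn_bigcup proper_bigcup.
have xSp : proper [set y | exists a, y = x * a]%classic.
  split; first exact: right_ideal_principal.
  - by move=> [a /esym]; exact: xN1.
  - by exists 1; rewrite mulr1.
case: A0p => [A0|[rA A1 Ax]].
  exfalso; apply: (Amax [set y | exists a, y = x * a]%classic); last by right.
  rewrite A0; split; first by move=> y [].
  by move=> /(_ x); apply; exists 1; rewrite mulr1.
exists (fun y => `[< A y >]); last by apply/asboolP.
split=> //; first by apply/negP => /asboolP.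
move=> J rJ J1 AJ y; apply/idP/idP => [Jy|]; last exact: AJ.
apply/asboolP; apply: contrapT => nAy; apply: (Amax [set z | z \in J]%classic).
  split; last by move=> /(_ y)/(_ Jy).
  by move=> z Az; apply: AJ; exact: asboolT.
right; split; last by apply: AJ; exact: asboolT.
- have -> : (fun z => `[< [set u | u \in J]%classic z >]) = (fun z => z \in J).
    by apply/funext => z; exact: asboolb.
  by split; [split; [exact: rJ.1.1|exact: rJ.1.2]|exact: rJ.2].
- by move=> /=; exact/negP.
Qed.

(** The unique maximal right ideal contains every [x] without right inverse,
    since [x S] then lies in some maximal right ideal.  An element outside has a
    right inverse, which again lies outside, and so is a unit; left stability
    follows, as a one-sided inverse of an element of [M] would give
    [1] in [M]. *)
Lemma local_ring_radical : local_ring S ->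
  exists M : {pred S}, [/\
    (forall x y, x \in M -> y \in M -> x + y \in M),
    (forall a x, x \in M -> a * x \in M),
    (forall x a, x \in M -> x * a \in M),
    1 \notin M
  & forall x, x \notin M -> exists y, x * y = 1 /\ y * x = 1].
Proof.
move=> [M [[[M0 MB] Mr] M1 _] Muniq].
have MN x : x \in M -> - x \in M by move=> Mx; rewrite -sub0r; exact: MB.
have MD x y : x \in M -> y \in M -> x + y \in M.
  by move=> Mx My; rewrite -(opprK y); apply: MB => //; exact: MN.
have rinv x : x \notin M -> exists y, x * y = 1.
  move=> Mx; apply: contrapT => xN1.
  have [I mI Ix] : exists2 I : {pred S}, maximal_right_ideal I & x \in I.
    by apply: maximal_right_ideal_exists => a xa; apply: xN1; exists a.
  by move: Mx; rewrite -(Muniq I mI) Ix.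
have unit x : x \notin M -> exists y, x * y = 1 /\ y * x = 1.
  move=> Mx; have [y xy] := rinv x Mx.
  have [My|/rinv[z yz]] := boolP (y \in M).
    have : 1 - y * x \notin M.
      apply/negP => M1yx; case/negP: M1.
      by rewrite -(subrK (y * x) 1); apply: MD => //; exact: Mr.
    move=> /rinv[z yxz]; case/negP: Mx.
    suff -> : x = 0 by [].
    by rewrite -(mulr1 x) -yxz mulrA mulrBr mulr1 mulrA xy mul1r subrr mul0r.
  exists y; split=> //.
  suff -> : x = z by [].
  by rewrite -(mulr1 x) -yz mulrA xy mul1r.
exists M; split=> // a x Mx.
apply/negPn/negP => /unit[b [_ bax]].
have [Mba|/unit[c [bac cba]]] := boolP (b * a \in M).
  by case/negP: M1; rewrite -bax mulrA; exact: Mr.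
have xc : x = c by rewrite -[x]mul1r -cba -!mulrA bax mulr1.
by case/negP: M1; rewrite -cba -xc; exact: Mr.
Qed.

End LocalRing.

(** * Nakayama elimination *)

(** Gaussian elimination: as [1 - a z z] is invertible, the equation for [u z]
    expresses it through the remaining unknowns, and the new coefficients are
    again in the left ideal [M].  The equations are required at every [x], not
    only on [s], so that the head of [s] can be removed without comparing
    indices. *)
Lemma nakayama (K : pzRingType) (U : lmodType K) (M : {pred End_mod U})
    (X : Type) (s : seq X) (u : X -> U) (a : X -> X -> End_mod U) :
  (forall f g, f \in M -> g \in M -> f + g \in M) ->
  (forall f g, g \in M -> f * g \in M) ->
  (forall f, f \in M -> exists g : End_mod U, g * (1 - f) = 1) ->
  (forall x y, a x y \in M) ->
  (forall x, u x = \sum_(y <- s) End_fun (a x y) (u y)) ->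
  forall x, u x = 0.
Proof.
move=> MD Ml Minv; elim: s a => [|z s IH] a Ma ua x.
  by rewrite ua big_nil.
have [b bP] := Minv _ (Ma z z).
have uz : u z = \sum_(y <- s) End_fun (b * a z y) (u y).
  transitivity (End_fun (b * (1 - a z z)) (u z)); first by rewrite bP.
  change (End_fun b (u z - End_fun (a z z) (u z)) = 
          \sum_(y <- s) End_fun b (End_fun (a z y) (u y))).
  by rewrite -raddf_sum {1}ua big_cons [X in X - _]addrC addrK.
apply: (IH (fun x y => a x z * (b * a z y) + a x y)).
  by move=> x' y; apply: (MD _ _ _ (Ma _ _)); apply: (Ml); apply: (Ml).
move=> y; rewrite [LHS]ua big_cons {1}uz raddf_sum -big_split /=.
by apply: eq_bigr.
Qed.

(** * Direct powers *)

Section DirectPower.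
Context (K : pzRingType) (U : lmodType K) (X : Type).
Local Notation UX := (direct_power U X).

Lemma dp_ext (u v : UX) : u =1 v -> u = v.
Proof. by move=> /funext uv; exact: val_inj. Qed.

Lemma dp_add (u v : UX) x : (u + v) x = u x + v x.
Proof. by []. Qed.

Lemma dp_scale a (u : UX) x : (a *: u) x = a *: u x.
Proof. by []. Qed.

Lemma dp_zero x : (0 : UX) x = 0.
Proof. by []. Qed.

Lemma dp_sum (I : Type) (s : seq I) (F : I -> UX) x :
  (\sum_(i <- s) F i) x = \sum_(i <- s) F i x.
Proof. exact: (big_morph (fun v : UX => v x) (fun u v => erefl) erefl). Qed.

Lemma dp_supp_exists (w : UX) :
  exists s : seq {classic X}, uniq s /\ forall x, (x \in s) = (w x != 0).
Proof.
have /asboolP/(@finite_seqP {classic X})[s sE] := valP w.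
exists (undup s); split=> [|x]; first exact: undup_uniq.
rewrite mem_undup; apply/idP/idP => xs.
  by change ([set x | val w x != 0]%classic x); rewrite sE.
by change ([set` s]%classic x); rewrite -sE.
Qed.

Definition dp_supp (w : UX) : seq {classic X} :=
  projT1 (cid (dp_supp_exists w)).

Lemma dp_supp_uniq w : uniq (dp_supp w).
Proof. by rewrite /dp_supp; case: cid => s []. Qed.

Lemma mem_dp_supp w x : (x \in dp_supp w) = (w x != 0).
Proof. by rewrite /dp_supp; case: cid => s []. Qed.

Lemma dp_single_subproof (x : X) (a : U) :
  (fun y : X => if `[< y = x >] then a else 0) \in finsupp_fun (U:=U) (X:=X).
Proof.
apply/asboolP; apply: (sub_finite_set _ (finite_set1 x)) => y /=.
by case: asboolP => // _; rewrite eqxx.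
Qed.

Definition dp_single x a : UX := DirectPower (dp_single_subproof x a).

Lemma dp_single_linear x : linear (dp_single x).
Proof.
move=> k a b; apply: dp_ext => y; rewrite dp_add dp_scale /=.
by case: asboolP => _ //; rewrite scaler0 addr0.
Qed.
HB.instance Definition _ x := GRing.isLinear.Build K U UX *:%R (dp_single x)
  (dp_single_linear x).

Definition dp_proj (x : X) (w : UX) : U := w x.
HB.instance Definition _ x := GRing.isLinear.Build K UX U *:%R (dp_proj x)
  (fun k u v => erefl).

Section Copair.
Context (V : lmodType K) (j : X -> {linear U -> V}).

(** The map out of the coproduct [U^(X)] with components [j x]. *)
Definition dp_copair (w : UX) : V := \sum_(x <- dp_supp w) j x (w x).

(** Summing over any finite set that contains the support allows two elements
    with different supports to be compared. *)
Lemma dp_copairE (w : UX) (s : seq {classic X}) : uniq s ->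
  (forall x, w x != 0 -> x \in s) -> dp_copair w = \sum_(x <- s) j x (w x).
Proof.
move=> us ws; rewrite (bigID (fun x => w x != 0)) /= [X in _ + X]big1 ?addr0.
  rewrite -big_filter; apply: perm_big; apply: uniq_perm.
  - exact: dp_supp_uniq.
  - exact: filter_uniq.
  move=> x; rewrite mem_filter mem_dp_supp.
  by case: (boolP (w x != 0)) => //= /ws ->.
by move=> x; rewrite negbK => /eqP ->; rewrite raddf0.
Qed.

Lemma dp_copair_linear : linear dp_copair.
Proof.
move=> k u v; set s := undup (dp_supp u ++ dp_supp v).
have us : uniq s by exact: undup_uniq.
have sE x : (x \in s) = (u x != 0) || (v x != 0).
  by rewrite mem_undup mem_cat !mem_dp_supp.
have -> : dp_copair u = \sum_(x <- s) j x (u x).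
  by apply: dp_copairE => // x nz; rewrite sE nz.
have -> : dp_copair v = \sum_(x <- s) j x (v x).
  by apply: dp_copairE => // x nz; rewrite sE nz orbT.
rewrite (@dp_copairE _ s) //; last first.
  move=> x; rewrite sE dp_add dp_scale; apply: contraNT.
  by rewrite negb_or !negbK => /andP[/eqP -> /eqP ->]; rewrite scaler0 addr0.
rewrite scaler_sumr -big_split /=; apply: eq_bigr => x _.
exact: linearP.
Qed.
HB.instance Definition _ := GRing.isLinear.Build K UX V *:%R dp_copair
  dp_copair_linear.

Lemma dp_copair_single x a : dp_copair (dp_single x a) = j x a.
Proof.
rewrite (@dp_copairE _ [:: x : {classic X}]) //.
  by rewrite big_seq1 /=; case: asboolP.
move=> y /=; case: asboolP => [->|]; last by rewrite eqxx.
by move=> _; exact: (@mem_head {classic X} x [::]).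
Qed.

End Copair.

Lemma dp_decomp (w : UX) : w = \sum_(x <- dp_supp w) dp_single x (w x).
Proof.
apply: dp_ext => y; rewrite dp_sum.
have [ys|yNs] := boolP ((y : {classic X}) \in dp_supp w).
  rewrite (bigD1_seq (y : {classic X}) ys (dp_supp_uniq w)) /=.
  case: asboolP => // _; rewrite big1 ?addr0 // => x xy.
  by case: asboolP => // yx; rewrite yx eqxx in xy.
have wy : w y = 0 by apply/eqP/negPn; rewrite -mem_dp_supp.
rewrite wy big1_seq // => x /andP[_ xs] /=.
by case: asboolP => // <-.
Qed.

Lemma dp_linear_ext (V : lmodType K) (F G : {linear UX -> V}) :
  (forall x a, F (dp_single x a) = G (dp_single x a)) -> F =1 G.
Proof.
move=> FG w; rewrite (dp_decomp w) !raddf_sum.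
by apply: eq_bigr => x _; exact: FG.
Qed.

Lemma in_Add_direct_power : in_Add U UX.
Proof.
exists X, (fun=> true); split.
  split=> //; exists (fun w => w == 0); split.
  - split=> [|k u v]; rewrite !unfold_in //.
    by move=> /eqP -> /eqP ->; rewrite scaler0 addr0.
  - by move=> w _ /eqP.
  - by move=> w; exists w, 0; rewrite addr0 inE.
exists idfun; split=> // w; split=> // _.
by exists w.
Qed.

End DirectPower.

Section DirectPowerMap.
Context (K : pzRingType) (U : lmodType K) (X : Type).
Local Notation UX := (direct_power U X).
Context (e : X -> End_mod U).

Lemma dp_map_subproof (w : UX) :
  (fun x => End_fun (e x) (w x)) \in finsupp_fun (U:=U) (X:=X).
Proof.
apply/asboolP; have /asboolP := valP w; apply: sub_finite_set => x /=.
by apply: contra_neq => /= ->; rewrite raddf0.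
Qed.

Definition dp_map (w : UX) : UX := DirectPower (dp_map_subproof w).

Lemma dp_map_linear : linear dp_map.
Proof. by move=> k u v; apply: dp_ext => x; rewrite /= !linearP. Qed.
HB.instance Definition _ := GRing.isLinear.Build K UX UX *:%R dp_map
  dp_map_linear.

Lemma dp_map_single x a :
  dp_map (dp_single x a) = dp_single x (End_fun (e x) a).
Proof.
by apply: dp_ext => y /=; case: asboolP => [->|] //; rewrite raddf0.
Qed.

End DirectPowerMap.

(** * Fixed vectors of radical endomorphisms *)

(** Only finitely many coordinates of [w] are nonzero, and for these the fixed
    point equation is a square system whose coefficients
    [(T e)_xy = T_xy e_y] are in [M].  The matrix of [T] itself may be infinite,
    but it enters only through the columns in the support of [w]. *)
Lemma radical_diagonal_fixed0 (K : pzRingType) (U : lmodType K)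
    (M : {pred End_mod U}) (X : Type) (e : X -> End_mod U)
    (T : {linear direct_power U X -> direct_power U X})
    (w : direct_power U X) :
  (forall f g, f \in M -> g \in M -> f + g \in M) ->
  (forall f g, g \in M -> f * g \in M) ->
  (forall f, f \in M -> exists g : End_mod U, g * (1 - f) = 1) ->
  (forall x, e x \in M) -> T (dp_map e w) = w -> w = 0.
Proof.
move=> MD Ml Minv Me Tw; apply: dp_ext => x; rewrite dp_zero.
pose t y z : End_mod U := dp_proj y \o T \o dp_single z : {linear U -> U}.
pose a y z : End_mod U := t y z * e z.
apply: (@nakayama _ _ M _ (dp_supp w) _ a) => //.
  by move=> y z; exact: Ml.
move=> {}x; rewrite -[in LHS]Tw {1}(dp_decomp w) !raddf_sum dp_sum.
apply: eq_bigr => y _.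
by rewrite -[LHS]/(T (dp_map e (dp_single y (w y))) x) dp_map_single.
Qed.

(** * Maps between uniserial modules *)

Section Linear.
Context (K : pzRingType).

Lemma linear_lift (U V W : lmodType K) (g : {linear W -> V})
    (f : {linear U -> V}) : injective g -> (forall u, exists w, g w = f u) ->
  exists h : {linear U -> W}, forall u, g (h u) = f u.
Proof.
move=> ginj fg; pose h u := projT1 (cid (fg u)).
have hE u : g (h u) = f u by rewrite /h; case: cid.
have hlin : linear h.
  by move=> a u v; apply: ginj; rewrite linearP !hE linearP.
pose hL := GRing.isLinear.Build K U W *:%R h hlin.
pose H : {linear U -> W} := HB.pack h hL.
by exists H.
Qed.

Lemma kernel_submod_closed (U V : lmodType K) (f : {linear U -> V}) :
  submod_closed (fun u => f u == 0).
Proof.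
split=> [|a u v]; rewrite !unfold_in; first by rewrite raddf0.
by rewrite linearP => /eqP -> /eqP ->; rewrite scaler0 addr0.
Qed.

Lemma image_submod_closed (U V : lmodType K) (f : {linear U -> V}) :
  submod_closed (fun v => `[< exists u, f u = v >]).
Proof.
split=> [|a u v]; rewrite !unfold_in.
  by apply/asboolP; exists 0; rewrite raddf0.
move=> /asboolP[x <-] /asboolP[y <-]; apply/asboolP.
by exists (a *: x + y); rewrite linearP.
Qed.

(** The kernels of [g] and [j + g] meet trivially because [j] is monic, and [g]
    has nonzero kernel, so [j + g] is monic by uniseriality of [U].  Dually, the
    images of [j] and [j + g] together generate that of [g], which is [V], and
    the image of [j] is proper, so [j + g] is onto by uniseriality of [V]. *)
Lemma mono_add_epi_iso (U V : lmodType K) (j g : {linear U -> V}) :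
  uniserial U -> uniserial V ->
  injective j -> ~ (forall v, exists u, j u = v) ->
  (forall v, exists u, g u = v) -> ~ injective g ->
  exists h : {linear U -> V}, injective h /\ forall v, exists u, h u = v.
Proof.
move=> Uu Vu jinj jnsurj gsurj gninj.
have [h hE] : exists h : {linear U -> V}, forall u, h u = j u + g u.
  by exists (j \+ g).
exists h; split.
  apply: raddf_inj => u hu0.
  case: (Uu _ _ (kernel_submod_closed h) (kernel_submod_closed g)) => sub.
    have /eqP gu : g u == 0 by apply: (sub u); rewrite unfold_in hu0.
    by apply: jinj; rewrite raddf0 -[RHS](hu0 : h u = 0) hE gu addr0.
  exfalso; apply: gninj; apply: raddf_inj => v gv0.
  have /eqP hv : h v == 0 by apply: (sub v); rewrite unfold_in gv0.
  by apply: jinj; rewrite raddf0 -[RHS](hv : h v = 0) hE (gv0 : g v = 0) addr0.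
have gE u : g u = h u - j u by rewrite hE addrC addKr.
case: (Vu _ _ (image_submod_closed j) (image_submod_closed h)) => sub v.
  have [u gu] := gsurj v.
  have /asboolP[u' ju] : `[< exists x, h x = j u >].
    by apply: (sub (j u)); apply/asboolP; exists u.
  by exists (u - u'); rewrite -gu gE -ju raddfB.
exfalso; apply: jnsurj => {}v; have [u <-] := gsurj v.
have /asboolP[u' ju] : `[< exists x, j x = h u >].
  by apply: (sub (h u)); apply/asboolP; exists u.
by exists (u' - u); rewrite gE -ju raddfB.
Qed.

(** * Absence of covers *)

Lemma in_Add_retract (U C : lmodType K) : in_Add U C ->
  exists (X : Type) (i : {linear C -> direct_power U X})
    (p : {linear direct_power U X -> C}), cancel i p.
Proof.
move=> [X [D [[Dsub [E [Esub DE0 DE]]] [i [iinj iD]]]]].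
exists X, i.
have dec w : exists c, w - i c \in E.
  have [d [e [dD eE ->]]] := DE w; have /iD[c <-] := dD.
  by exists c; rewrite addrC addKr.
pose p w := projT1 (cid (dec w)).
have pE w : w - i (p w) \in E by rewrite /p; case: cid.
have puniq w c : w - i c \in E -> p w = c.
  move=> wc; apply: iinj; apply/eqP; rewrite -subr_eq0; apply/eqP.
  have [_ Elin] := Esub; rewrite -raddfB.
  apply: DE0; first by apply/iD; exists (p w - c).
  have := Elin (-1) _ _ (pE w) wc.
  by rewrite scaleN1r opprB addrA subrK raddfB.
have plin : linear p.
  move=> a u v; apply: puniq.
  have [_ Elin] := Esub; have := Elin a _ _ (pE u) (pE v).
  by rewrite linearP scalerBr opprD addrACA.
pose pL := GRing.isLinear.Build K _ C *:%R p plin.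
pose P : {linear direct_power U X -> C} := HB.pack p pL.
exists P => c; apply: puniq; rewrite subrr; exact: Esub.1.
Qed.

(** If every [v] lies in a copy of [U], but [V] is not a copy of [U], then all
    maps [U -> V] factor through an endomorphism of [U] in [M].  A precover
    [f : C -> V] then satisfies [f h = f] for some [h] built from such
    endomorphisms, and [h] can be invertible only if [C = 0]. *)
Lemma no_Add_cover (U V : lmodType K) :
  uniserial_type1 U -> uniserial V ->
  (forall v, exists2 j : {linear U -> V}, injective j & exists u, j u = v) ->
  (forall j : {linear U -> V}, injective j -> ~ forall v, exists u, j u = v) ->
  ~ exists (C : lmodType K) (f : {linear C -> V}), Add_cover U f.
Proof.
move=> [Uu [u0 u0nz] Sloc] Vu Vunion UNV.
have [M [MD Ml _ M1 Munit]] := local_ring_radical Sloc.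
have Minv f : f \in M -> exists g : End_mod U, g * (1 - f) = 1.
  move=> Mf; have /Munit[g [_ gf]] : 1 - f \notin M.
    by apply: contra M1 => Mf1; rewrite -(subrK f 1); exact: MD.
  by exists g.
have epiN (g : {linear U -> V}) : exists v, forall u, g u <> v.
  apply: contrapT => gsurj.
  have {}gsurj v : exists u, g u = v.
    apply: contrapT => nv; apply: gsurj; exists v => u gu.
    by apply: nv; exists u.
  have [ginj|gninj] := pselect (injective g); first exact: UNV ginj gsurj.
  (* Any embedding will do; the one through 0 is at hand. *)
  have [j jinj _] := Vunion 0.
  by have [h [hinj hsurj]] :=
    mono_add_epi_iso Uu Vu jinj (UNV j jinj) gsurj gninj; exact: UNV hinj hsurj.
have factor (g : {linear U -> V}) :
    exists (j : {linear U -> V}) (e : End_mod U),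
      e \in M /\ forall u, j (End_fun e u) = g u.
  have [v vg] := epiN g; have [j jinj [w jw]] := Vunion v.
  have gj u : exists w, j w = g u.
    case: (Vu _ _ (image_submod_closed g) (image_submod_closed j)) => sub.
      by apply/asboolP; apply: (sub (g u)); apply/asboolP; exists u.
    have /asboolP[u' gu'] : `[< exists x, g x = v >].
      by apply: (sub v); apply/asboolP; exists w.
    by have := vg u'.
  have [e0 eP] := linear_lift jinj gj; pose e : End_mod U := e0.
  (* A unit [e] would make [v] a value of [g]. *)
  exists j, e; split=> //; apply/negPn/negP => /Munit[e' [ee' _]].
  apply: (vg (End_fun e' w)); rewrite -eP -jw; congr (j _).
  by rewrite -[LHS]/(End_fun ((e : End_mod U) * e' : End_mod U) w) ee'.
move=> [C [f [[AddC fpre] fcov]]].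
have [X [i [p ip]]] := in_Add_retract AddC.
pose F x : {linear U -> V} := f \o p \o dp_single x.
have [je jeP] := @choice _ _ (fun x (t : {linear U -> V} * End_mod U) =>
    t.2 \in M /\ forall u, t.1 (End_fun t.2 u) = F x u)
  (fun x => let: ex_intro j (ex_intro e jeE) := factor (F x) in
            ex_intro _ (j, e) jeE).
pose e x := (je x).2; pose j x := (je x).1.
have [k fk] :=
  fpre _ (dp_copair j : {linear _ -> _}) (in_Add_direct_power U X).
have fkE : f \o k \o dp_map e =1 f \o p.
  apply: dp_linear_ext => x a.
  rewrite -[LHS]/(f (k (dp_map e (dp_single x a)))) dp_map_single.
  rewrite -[LHS]/((f \o k) _) fk -[LHS]/(dp_copair j _) dp_copair_single.
  exact: (jeP x).2.
pose h : {linear C -> C} := k \o dp_map e \o i.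
have fh : f \o h =1 f.
  by move=> c; rewrite -[LHS]/((f \o k \o dp_map e) (i c)) fkE /= ip.
have [h' hh' h'h] := fcov h fh.
have [q hq] : exists q : {linear C -> C}, forall c, h (q c) = c.
  apply: (@linear_lift _ _ _ h idfun); first exact: can_inj hh'.
  by move=> c; exists (h' c); rewrite h'h.
have qh c : q (h c) = c by apply: (can_inj hh'); rewrite hq.
have C0 (c : C) : c = 0.
  suff ic0 : i c = 0 by rewrite -(ip c) ic0 raddf0.
  apply: (@radical_diagonal_fixed0 _ _ M X e (i \o q \o k)) => //.
    by move=> x; exact: (jeP x).1.
  by rewrite -[LHS]/(i (q (h c))) qh.
(* An embedding of [U], seen as a map on the direct power with one factor,
   cannot factor through the zero module. *)
have [j0 j0inj _] := Vunion 0.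
have [l fl] := fpre _ (dp_copair (fun _ : unit => j0) : {linear _ -> _})
  (in_Add_direct_power U unit).
have := fl (dp_single tt u0).
rewrite /= dp_copair_single (C0 (l _)) raddf0 => /esym j0u0.
by move/eqP: u0nz; apply; apply: j0inj; rewrite j0u0 raddf0.
Qed.

End Linear.

(** * Unions of chains of copies of a module *)

Section ChainUnion.
Context (K : pzRingType) (U : lmodType K) (O : Type).

(** An injection [i : U -> O] stands for the module with underlying set [i U]
    and structure transported from [U].  If [i = j s] with [s] linear,
    then [i U] is a submodule of [j U]; submodule inclusions
    are encoded in this way, without module structures on subsets of [O]. *)
Definition linear_factor (i j : U -> O) : Prop :=
  exists s : {linear U -> U}, forall u, i u = j (s u).

Definition linear_chain (A : set (U -> O)) : Prop :=
  [/\ (exists i, A i), (forall i, A i -> injective i)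
    & forall i j, A i -> A j -> linear_factor i j \/ linear_factor j i].

Definition chain_union (A : set (U -> O)) (cA : linear_chain A) : Type :=
  {w : O | exists2 i, A i & exists u, i u = w}.

Context (A : set (U -> O)) (cA : linear_chain A).
Local Notation W := (chain_union cA).

HB.instance Definition _ := gen_eqMixin W.
HB.instance Definition _ := gen_choiceMixin W.

Definition cu_val : W -> O := @sval _ _.

Definition cu_in (i : U -> O) (Ai : A i) (u : U) : W :=
  exist _ (i u) (ex_intro2 _ _ i Ai (ex_intro _ u erefl)).

Lemma cu_val_inj : injective cu_val.
Proof. by move=> [v Pv] [w Pw] /= vw; apply: eq_exist. Qed.

Lemma cu_in_factor i j (Ai : A i) (Aj : A j) : linear_factor i j ->
  forall u, exists v, cu_in Ai u = cu_in Aj v.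
Proof. by move=> [s ij] u; exists (s u); apply: cu_val_inj; rewrite /= ij. Qed.

Lemma cu_directed i j (Ai : A i) (Aj : A j) : exists k, exists Ak : A k,
  (forall u, exists v, cu_in Ai u = cu_in Ak v) /\
  (forall u, exists v, cu_in Aj u = cu_in Ak v).
Proof.
have [_ _ /(_ i j Ai Aj)[ij|ji]] := cA.
  by exists j, Aj; split=> u; [exact: cu_in_factor|exists u].
by exists i, Ai; split=> u; [exists u|exact: cu_in_factor].
Qed.

Lemma cu_in_surj (w : W) : exists i, exists (Ai : A i) u, w = cu_in Ai u.
Proof.
by case: w => w [i Ai [u iu]]; exists i, Ai, u; apply: cu_val_inj.
Qed.

Lemma cu_joint2 (v w : W) :
  exists i, exists (Ai : A i) x y, v = cu_in Ai x /\ w = cu_in Ai y.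
Proof.
have [i [Ai [x ->]]] := cu_in_surj v; have [j [Aj [y ->]]] := cu_in_surj w.
have [k [Ak [/(_ x)[x' ->] /(_ y)[y' ->]]]] := cu_directed Ai Aj.
by exists k, Ak, x', y'.
Qed.

Lemma cu_joint3 (v w t : W) : exists i, exists (Ai : A i) x y z,
  [/\ v = cu_in Ai x, w = cu_in Ai y & t = cu_in Ai z].
Proof.
have [i [Ai [x [y [-> ->]]]]] := cu_joint2 v w.
have [j [Aj [z ->]]] := cu_in_surj t.
have [k [Ak [ik jk]]] := cu_directed Ai Aj.
have [[[x' ->] [y' ->]] [z' ->]] := (ik x, ik y, jk z).
by exists k, Ak, x', y', z'.
Qed.

(** Addition, opposite and scaling are all instances of one operation
    [a v + b w], whose independence of the chosen copy of [U] is checked once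
    here. *)
Lemma cu_comb_exists (a b : K) (v w : W) : exists r : W,
  forall i (Ai : A i) x y, v = cu_in Ai x -> w = cu_in Ai y ->
    r = cu_in Ai (a *: x + b *: y).
Proof.
have [i [Ai [x [y [-> ->]]]]] := cu_joint2 v w.
exists (cu_in Ai (a *: x + b *: y)) => j Aj x' y' xx' yy'.
have {}xx' : i x = j x' := congr1 cu_val xx'.
have {}yy' : i y = j y' := congr1 cu_val yy'.
apply: cu_val_inj => /=; have [_ inj /(_ i j Ai Aj)] := cA.
case=> -[s sE]; rewrite ?sE in xx' yy' *.
  by rewrite linearP linearZ (inj _ Aj _ _ xx') (inj _ Aj _ _ yy').
by rewrite linearP linearZ (inj _ Ai _ _ xx') (inj _ Ai _ _ yy').
Qed.

Definition cu_comb a b v w : W := projT1 (cid (cu_comb_exists a b v w)).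

Lemma cu_combE a b i (Ai : A i) x y :
  cu_comb a b (cu_in Ai x) (cu_in Ai y) = cu_in Ai (a *: x + b *: y).
Proof. by rewrite /cu_comb; case: cid => r /= rE; exact: rE. Qed.

Lemma cu_zero_exists : exists r : W, forall i (Ai : A i), r = cu_in Ai 0.
Proof.
have [[i Ai] inj chain] := cA; exists (cu_in Ai 0) => j Aj.
by apply: cu_val_inj => /=; case: (chain i j Ai Aj) => -[s ->]; rewrite raddf0.
Qed.

Definition cu_zero : W := projT1 (cid cu_zero_exists).

Lemma cu_zeroE i (Ai : A i) : cu_zero = cu_in Ai 0.
Proof. by rewrite /cu_zero; case: cid. Qed.

Definition cu_add := cu_comb 1 1.
Definition cu_opp v := cu_comb (-1) 0 v v.
Definition cu_scale a v := cu_comb a 0 v v.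

Lemma cu_addE i (Ai : A i) x y :
  cu_add (cu_in Ai x) (cu_in Ai y) = cu_in Ai (x + y).
Proof. by rewrite /cu_add cu_combE !scale1r. Qed.

Lemma cu_oppE i (Ai : A i) x : cu_opp (cu_in Ai x) = cu_in Ai (- x).
Proof. by rewrite /cu_opp cu_combE scaleN1r scale0r addr0. Qed.

Lemma cu_scaleE a i (Ai : A i) x : cu_scale a (cu_in Ai x) = cu_in Ai (a *: x).
Proof. by rewrite /cu_scale cu_combE scale0r addr0. Qed.

Fact cu_addA : associative cu_add.
Proof.
move=> u v w; have [i [Ai [x [y [z [-> -> ->]]]]]] := cu_joint3 u v w.
by rewrite !cu_addE addrA.
Qed.

Fact cu_addC : commutative cu_add.
Proof.
move=> u v; have [i [Ai [x [y [-> ->]]]]] := cu_joint2 u v.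
by rewrite !cu_addE addrC.
Qed.

Fact cu_add0 : left_id cu_zero cu_add.
Proof.
move=> u; have [i [Ai [x ->]]] := cu_in_surj u.
by rewrite (cu_zeroE Ai) cu_addE add0r.
Qed.

Fact cu_addN : left_inverse cu_zero cu_opp cu_add.
Proof.
move=> u; have [i [Ai [x ->]]] := cu_in_surj u.
by rewrite (cu_zeroE Ai) cu_oppE cu_addE addNr.
Qed.

HB.instance Definition _ :=
  GRing.isZmodule.Build W cu_addA cu_addC cu_add0 cu_addN.

Fact cu_scaleA a b v : cu_scale a (cu_scale b v) = cu_scale (a * b) v.
Proof.
by have [i [Ai [x ->]]] := cu_in_surj v; rewrite !cu_scaleE scalerA.
Qed.

Fact cu_scale1 : left_id 1 cu_scale.
Proof.
by move=> v; have [i [Ai [x ->]]] := cu_in_surj v; rewrite cu_scaleE scale1r.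
Qed.

Fact cu_scaleDr : right_distributive cu_scale +%R.
Proof.
move=> a u v; have [i [Ai [x [y [-> ->]]]]] := cu_joint2 u v.
by rewrite /GRing.add /= !(cu_addE, cu_scaleE) scalerDr.
Qed.

Fact cu_scaleDl v : {morph cu_scale^~ v : a b / a + b}.
Proof.
move=> a b; have [i [Ai [x ->]]] := cu_in_surj v.
by rewrite /GRing.add /= !cu_scaleE cu_addE scalerDl.
Qed.

HB.instance Definition _ := GRing.Zmodule_isLmodule.Build K W
  cu_scaleA cu_scale1 cu_scaleDr cu_scaleDl.

Lemma cu_in_linear i (Ai : A i) : linear (cu_in Ai).
Proof.
by move=> a u v; rewrite -cu_addE -cu_scaleE.
Qed.
HB.instance Definition _ i (Ai : A i) := GRing.isLinear.Build K U W *:%R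
  (cu_in Ai) (cu_in_linear Ai).

Lemma cu_in_inj i (Ai : A i) : injective (cu_in Ai).
Proof.
have [_ inj _] := cA.
by move=> u v /(congr1 cu_val); exact: (inj i Ai).
Qed.

Lemma chain_union_uniserial : uniserial U -> uniserial W.
Proof.
move=> Uu P Q Psub Qsub.
have pre (S : {pred W}) i (Ai : A i) : submod_closed S ->
    submod_closed (fun u => cu_in Ai u \in S).
  move=> [S0 Slin]; split=> [|a u v]; rewrite !unfold_in.
    by rewrite -[cu_in Ai 0]/((cu_in Ai : {linear U -> W}) 0) raddf0.
  by rewrite linearP; exact: Slin.
have [PQ|/existsNP[v /not_implyP[Pv Qv]]] := pselect {subset P <= Q}.
  by left.
right=> w Qw; have [i [Ai [x [y [vE wE]]]]] := cu_joint2 v w; subst v w.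
case: (Uu _ _ (pre P i Ai Psub) (pre Q i Ai Qsub)) => sub.
  by case: Qv; exact: (sub x).
exact: (sub y).
Qed.

End ChainUnion.

(** * A uniserial union of copies which is not a copy *)

(** Suppose that every uniserial union of copies of [U] is a copy of [U].  Order
    the injections of [U] into a set [O] by submodule inclusion.  Chains are
    bounded, since their union is a copy of [U], so there is a maximal [i].
    But if [O] is large enough, then [i] extends along [phi] to the
    strictly larger copy of [U] obtained by adjoining fresh elements for
    [U \ phi U].  Zorn's lemma on injections replaces the transfinite chain of
    extensions, and Cantor's theorem its cardinality bound. *)
Lemma exists_uniserial_union (K : pzRingType) (U : lmodType K)
    (phi : {linear U -> U}) :
  uniserial U -> injective phi -> ~ (forall y, exists x, phi x = y) ->
  exists V : lmodType K, [/\ uniserial V,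
    forall v, exists2 j : {linear U -> V}, injective j & exists u, j u = v
  & forall j : {linear U -> V}, injective j -> ~ forall v, exists u, j u = v].
Proof.
move=> Uu phi_inj phi_nsurj; apply: contrapT => noV.
(* By Cantor, the first components of the points of a copy of [U] miss some [P];
   the points [(P, u)] are then fresh. *)
pose O : Type := (set U * U)%type.
pose T := {i : U -> O | injective i}.
pose R (i j : T) := `[< linear_factor (sval i) (sval j) >].
have Rxx i : R i i by apply/asboolP; exists idfun.
have Rtrans i j k : R i j -> R j k -> R i k.
  move=> /asboolP[s ij] /asboolP[t jk]; apply/asboolP.
  by exists (t \o s) => u; rewrite ij jk.
pose i0 : T := exist _ (fun u => (set0, u)) (fun u v uv => congr1 snd uv).
have ub (A : set T) : total_on A R -> exists t, forall s, A s -> R s t.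
  move=> Atot; have [[a Aa]|nA] := pselect (exists a, A a); last first.
    by exists i0 => s As; case: nA; exists s.
  pose B : set (U -> O) := [set sval i | i in A]%classic.
  have cB : linear_chain B.
    split; first by exists (sval a), a.
      by move=> _ [i _ <-]; exact: (svalP i).
    move=> _ _ [i Ai <-] [j Aj <-].
    by case: (Atot i j Ai Aj) => /asboolP; [left|right].
  have [g [ginj gsurj]] : exists g : {linear U -> chain_union cB},
      injective g /\ forall v, exists u, g u = v.
    apply: contrapT => niso; apply: noV; exists (chain_union cB); split.
    - exact: chain_union_uniserial.
    - move=> v; have [i [Bi [u ->]]] := cu_in_surj v.
      by exists (cu_in cB Bi); [exact: cu_in_inj|exists u].
    - by move=> j jinj jsurj; apply: niso; exists j.
  have tinj : injective (fun u => cu_val (g u)).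
    by move=> u v /cu_val_inj/ginj.
  exists (exist _ _ tinj) => s As; apply/asboolP => /=.
  have Bs : B (sval s) by exists s.
  have [t tE] := linear_lift ginj (fun u => gsurj (cu_in cB Bs u)).
  by exists t => u; rewrite tE.
have [[i iinj] imax] := ZL_preorder i0 Rxx Rtrans ub.
(* The diagonal set of Cantor's argument. *)
have [P PN] : exists P : set U, forall u, (i u).1 <> P.
  exists [set u | ~ (i u).1 u]%classic => u E.
  have {}E : (i u).1 u = (~ (i u).1 u) by rewrite {1}E.
  have nP : ~ (i u).1 u by move=> h; move: (h); rewrite E; apply.
  by apply: (nP); rewrite E.
pose j u : O := if pselect (exists x, phi x = u) is left h
                then i (projT1 (cid h)) else (P, u).
have jphi x : j (phi x) = i x.
  rewrite /j; case: pselect => [h|[]]; last by exists x.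
  by case: cid => y /= /phi_inj ->.
have jN u : ~ (exists x, phi x = u) -> j u = (P, u).
  by rewrite /j; case: pselect.
have jinj : injective j.
  move=> u v; have [[x <-]|nu] := EM (exists x, phi x = u);
    have [[y <-]|nv] := EM (exists y, phi y = v).
  - by rewrite !jphi => /iinj ->.
  - by rewrite jphi (jN v) // => iP; case: (PN x); rewrite iP.
  - by rewrite jphi (jN u) // => iP; case: (PN y); rewrite -iP.
  - by rewrite !jN // => -[].
have /asboolP[s sE] : R (exist _ j jinj) (exist _ i iinj).
  by apply: imax; apply/asboolP; exists phi => u /=; rewrite jphi.
(* Maximality gives [j = i s], whereas [j] has values with first
   component [P]. *)
apply: phi_nsurj => y; apply: contrapT => ny.
by apply: (PN (s y)); rewrite -[i _]sE /= jN.
Qed.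

Theorem theorem3p4 (R : pzRingType) (U : lmodType R^c) :
  uniserial_type1 U ->
  (exists f : End_mod U,
    injective (End_fun f) /\ ~ (forall y : U, exists x : U, End_fun f x = y)) ->
  exists V : lmodType R^c,
    uniserial V /\
    ~ (exists (C : lmodType R^c) (f : {linear C -> V}), Add_cover U f).
Proof.
move=> U1 [phi [phi_inj phi_nsurj]]; have [Uu _ _] := U1.
have [V [Vu Vunion UNV]] := exists_uniserial_union Uu phi_inj phi_nsurj.
by exists V; split=> //; exact: no_Add_cover.
Qed.
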